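(* Let $k$ be an algebraically closed field, let $R$ be an associative $k$-algebra, and let $\mathcal{F}=\{M_1,\dots,M_p\}$ be a finite family of left $R$-modules such that $\dim_k\operatorname{Ext}^m_R(M_i,M_j)$ is finite for $1\le i,j\le p$ and $m=1,2$. Let $H$ be the pro-representable hull of the deformation functor $\mathrm{Def}_{\mathcal{F}}:\mathbf{a}_p\to\mathbf{Sets}$, and let $S$ be any object in $\mathbf{a}_p$. Then $\operatorname{Mor}(H,S)$ has a natural structure as an affine scheme over $k$. In particular, $\operatorname{Mor}(H,k[\Gamma])$ is an affine scheme over $k$ for any ordered quiver $\Gamma$ with $p$ nodes.
   Context: The category $\mathbf{A}_p$ of $p$-pointed $k$-algebras has as objects associative rings $S$ with structural ring homomorphisms $k^p\xrightarrow{f}S\xrightarrow{g}k^p$ with $g\circ f=\mathrm{id}$; morphisms are ring homomorphisms commuting with the structural maps. Put $I(S)=\ker g$ (the radical). For $e_1,\dots,e_p\in k^p$ the standard idempotents, put $S_{ij}=e_iSe_j$. The category $\mathbf{a}_p$ is the full subcategory of objects $S$ which are Artinian and complete in the $I(S)$-adic topology; equivalently, $S$ is finite dimensional over $k$ and $I(S)$ is nilpotent. $\mathbf{a}_p(n)$ is the full subcategory of $\mathbf{a}_p$ of objects with $I(S)^n=0$. The pro-category $\hat{\mathbf{a}}_p$ is the full subcategory of $\mathbf{A}_p$ of objects $S$ which are complete in the $I(S)$-adic topology and such that $S/I(S)^n$ is in $\mathbf{a}_p(n)$ for all $n\ge1$. $\operatorname{Mor}$ denotes the set of morphisms in $\mathbf{A}_p$.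 For $S$ in $\mathbf{a}_p$, a lifting of $\mathcal{F}$ to $S$ is a left $R\otimes_k S^{\mathrm{op}}$-module $M_S$ together with isomorphisms $\eta_i:M_S\otimes_S k_i\to M_i$ of left $R$-modules for $1\le i\le p$ (where $k_i$ is the $i$-th factor of $k^p$, an $S$-module via $g$), such that $M_S\cong\bigoplus_{i,j}M_i\otimes_k S_{ij}$ as right $S$-modules. Two liftings $(M_S,\eta)$, $(M'_S,\eta')$ are equivalent if there is an isomorphism $\tau:M_S\to M'_S$ of left $R\otimes_kS^{\mathrm{op}}$-modules with $\eta'_i\circ(\tau\otimes_Sk_i)=\eta_i$ for all $i$. $\mathrm{Def}_{\mathcal{F}}(S)$ is the set of equivalence classes of liftings of $\mathcal{F}$ to $S$. A pro-representable hull of $\mathrm{Def}_{\mathcal{F}}$ is an object $H$ of $\hat{\mathbf{a}}_p$ such that there exists a morphism of functors $\operatorname{Mor}(H,-)\to\mathrm{Def}_{\mathcal{F}}$ on $\mathbf{a}_p$ which is smooth (for every surjection $S\to S'$ in $\mathbf{a}_p$, the map $\operatorname{Mor}(H,S)\to\operatorname{Mor}(H,S')\times_{\mathrm{Def}_{\mathcal{F}}(S')}\mathrm{Def}_{\mathcal{F}}(S)$ is surjective) and is an isomorphism when restricted to $\mathbf{a}_p(2)$. Under the finiteness hypotheses it is known that a hull exists and is unique up to non-canonical isomorphism. An ordered quiver $\Gamma$ is a finite connected quiver with a total order on its arrows such that the end of $a$ equals the start of $b$ whenever $b$ is the successor of $a$. Write its nodes as $1,\dots,p$ and its arrows as $a_{12}<a_{23}<\dots<a_{n-1,n}$,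 where $a_{i-1,i}$ goes from the node $l(i-1)$ to the node $l(i)$. Then $k[\Gamma]$ is the object of $\mathbf{a}_p(n)$ given by generators $x_{i-1,i}\in k[\Gamma]_{l(i),l(i-1)}$, $2\le i\le n$, with the relations $x_{j-1,j}x_{i-1,i}=0$ unless $i<j$, for $2\le i,j\le n$. *)

(* Defs.v *)
From HB Require Import structures.
From mathcomp Require Import all_boot all_order all_algebra.
From mathcomp Require Import boolp.
Set Implicit Arguments.
Unset Strict Implicit.
Unset Printing Implicit Defensive.
Import GRing.Theory.
Local Open Scope ring_scope.
Local Open Scope quotient_scope.

Section PresentedModule.
Variables (K : pzRingType) (X : Type).

Inductive mterm :=
| MVar of X
| MZero
| MAdd of mterm & mterm
| MOpp of mterm
| MScale of K & mterm.

HB.instance Definition _ := gen_eqMixin mterm.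
HB.instance Definition _ := gen_choiceMixin mterm.

Variable E : mterm -> mterm -> Prop.

Inductive meq : mterm -> mterm -> Prop :=
| MEbase s t : E s t -> meq s t
| MErefl t : meq t t
| MEsym s t : meq s t -> meq t s
| MEtrans s t u : meq s t -> meq t u -> meq s u
| MEadd s s' t t' : meq s s' -> meq t t' -> meq (MAdd s t) (MAdd s' t')
| MEopp s s' : meq s s' -> meq (MOpp s) (MOpp s')
| MEscale c s s' : meq s s' -> meq (MScale c s) (MScale c s')
| MEaddA s t u : meq (MAdd s (MAdd t u)) (MAdd (MAdd s t) u)
| MEaddC s t : meq (MAdd s t) (MAdd t s)
| MEadd0 s : meq (MAdd MZero s) s
| MEaddN s : meq (MAdd (MOpp s) s) MZero
| MEscaleA b c s : meq (MScale b (MScale c s)) (MScale (b * c) s)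
| MEscale1 s : meq (MScale 1 s) s
| MEscaleDr c s t : meq (MScale c (MAdd s t)) (MAdd (MScale c s) (MScale c t))
| MEscaleDl b c s : meq (MScale (b + c) s) (MAdd (MScale b s) (MScale c s)).

Lemma meq_equiv_class : equiv_class_of (fun s t => `[< meq s t >]).
Proof.
split=> [t|s t|t s u]; first by apply/asboolP; exact: MErefl.
  by apply/asboolP/asboolP => /MEsym.
by move=> /asboolP st /asboolP tu; apply/asboolP; exact: MEtrans st tu.
Qed.
Canonical meq_equiv := EquivRelPack meq_equiv_class.

Definition pmod : Type := {eq_quot meq_equiv}.
HB.instance Definition _ := Choice.on pmod.
HB.instance Definition _ := EqQuotient.on pmod.

Lemma pmodP s t : reflect (meq s t) (\pi_pmod s == \pi_pmod t).
Proof. by rewrite eqmodE; exact: asboolP. Qed.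

Lemma pmod_eq s t : meq s t -> \pi_pmod s = \pi_pmod t.
Proof. by move=> /pmodP/eqP. Qed.

Lemma repr_meq s : meq (repr (\pi_pmod s)) s.
Proof. by apply/pmodP; rewrite reprK. Qed.

Definition pm_zero : pmod := \pi_pmod MZero.
Definition pm_add (x y : pmod) : pmod := \pi_pmod (MAdd (repr x) (repr y)).
Definition pm_opp (x : pmod) : pmod := \pi_pmod (MOpp (repr x)).
Definition pm_scale c (x : pmod) : pmod := \pi_pmod (MScale c (repr x)).

Lemma pm_addE s t : pm_add (\pi_pmod s) (\pi_pmod t) = \pi_pmod (MAdd s t).
Proof. by apply: pmod_eq; apply: MEadd; exact: repr_meq. Qed.
Lemma pm_oppE s : pm_opp (\pi_pmod s) = \pi_pmod (MOpp s).
Proof. by apply: pmod_eq; apply: MEopp; exact: repr_meq. Qed.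
Lemma pm_scaleE c s : pm_scale c (\pi_pmod s) = \pi_pmod (MScale c s).
Proof. by apply: pmod_eq; apply: MEscale; exact: repr_meq. Qed.

Lemma pm_addA : associative pm_add.
Proof.
elim/quotW=> s; elim/quotW=> t; elim/quotW=> u.
by rewrite (pm_addE t u) (pm_addE s t) !pm_addE; apply: pmod_eq;
  exact: MEaddA.
Qed.
Lemma pm_addC : commutative pm_add.
Proof.
elim/quotW=> s; elim/quotW=> t.
by rewrite !pm_addE; apply: pmod_eq; exact: MEaddC.
Qed.
Lemma pm_add0 : left_id pm_zero pm_add.
Proof. by elim/quotW=> s; rewrite pm_addE; apply: pmod_eq; exact: MEadd0. Qed.
Lemma pm_addN : left_inverse pm_zero pm_opp pm_add.
Proof.
by elim/quotW=> s; rewrite pm_oppE pm_addE; apply: pmod_eq; exact: MEaddN.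
Qed.
HB.instance Definition _ :=
  GRing.isZmodule.Build pmod pm_addA pm_addC pm_add0 pm_addN.

Lemma pm_scaleA b c (x : pmod) :
  pm_scale b (pm_scale c x) = pm_scale (b * c) x.
Proof.
elim/quotW: x => s; rewrite (pm_scaleE c s) !pm_scaleE; apply: pmod_eq.
exact: MEscaleA.
Qed.
Lemma pm_scale1 : left_id 1 pm_scale.
Proof.
by elim/quotW=> s; rewrite pm_scaleE; apply: pmod_eq; exact: MEscale1.
Qed.
Lemma pm_scaleDr : right_distributive pm_scale +%R.
Proof.
move=> c; elim/quotW=> s; elim/quotW=> t.
transitivity (\pi_pmod (MScale c (MAdd s t))).
  by rewrite -pm_scaleE -pm_addE.
transitivity (pm_add (\pi_pmod (MScale c s)) (\pi_pmod (MScale c t))).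
  by rewrite pm_addE; apply: pmod_eq; exact: MEscaleDr.
by rewrite -!pm_scaleE.
Qed.
Lemma pm_scaleDl (x : pmod) : {morph pm_scale^~ x : b c / b + c}.
Proof.
elim/quotW: x => s b c.
transitivity (pm_add (\pi_pmod (MScale b s)) (\pi_pmod (MScale c s))).
  by rewrite pm_addE pm_scaleE; apply: pmod_eq; exact: MEscaleDl.
by rewrite -!pm_scaleE.
Qed.
HB.instance Definition _ := GRing.Zmodule_isLmodule.Build K pmod
  pm_scaleA pm_scale1 pm_scaleDr pm_scaleDl.

Definition pgen (x : X) : pmod := \pi_pmod (MVar x).

Fixpoint meval (V : lmodType K) (f : X -> V) (t : mterm) : V :=
  match t with
  | MVar x => f x
  | MZero => 0
  | MAdd s t => meval f s + meval f t
  | MOpp s => - meval f s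
  | MScale c s => c *: meval f s
  end.

Lemma meval_pgen t : meval pgen t = \pi_pmod t.
Proof.
elim: t => //= [s -> t ->|s ->|c s ->].
- exact: pm_addE.
- exact: pm_oppE.
- exact: pm_scaleE.
Qed.

Lemma pmod_rel s t : E s t -> meval pgen s = meval pgen t.
Proof. by rewrite !meval_pgen => /MEbase/pmod_eq. Qed.

Lemma pmod_ind (P : pmod -> Prop) :
  P 0 -> (forall x, P (pgen x)) -> (forall u v, P u -> P v -> P (u + v)) ->
  (forall c u, P u -> P (c *: u)) -> forall u, P u.
Proof.
move=> P0 Pg PD PZ; elim/quotW=> t; rewrite -meval_pgen.
elim: t => //= [s Ps t Pt|s Ps|c s Ps]; [exact: PD| |exact: PZ].
by rewrite -scaleN1r; exact: PZ.
Qed.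

Section Lift.
Variables (V : lmodType K) (f : X -> V).

Definition pmod_lift (u : pmod) : V := meval f (repr u).

Hypothesis fE : forall s t, E s t -> meval f s = meval f t.

Lemma meval_meq s t : meq s t -> meval f s = meval f t.
Proof.
elim=> //=.
- by move=> ? ? ? _ -> _ ->.
- by move=> ? ? ? ? _ -> _ ->.
- by move=> ? ? _ ->.
- by move=> ? ? ? _ ->.
- by move=> *; rewrite addrA.
- by move=> *; rewrite addrC.
- by move=> *; rewrite add0r.
- by move=> *; rewrite addNr.
- by move=> *; rewrite scalerA.
- by move=> *; rewrite scale1r.
- by move=> *; rewrite scalerDr.
- by move=> *; rewrite scalerDl.
Qed.

Lemma pmod_lift_pi t : pmod_lift (\pi_pmod t) = meval f t.
Proof. by apply: meval_meq; exact: repr_meq. Qed.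

Lemma pmod_lift_gen x : pmod_lift (pgen x) = f x.
Proof. by rewrite pmod_lift_pi. Qed.

Lemma pmod_liftD : {morph pmod_lift : u v / u + v}.
Proof.
by elim/quotW=> s; elim/quotW=> t; rewrite [_ + _]pm_addE !pmod_lift_pi.
Qed.

Lemma pmod_liftZ c : {morph pmod_lift : u / c *: u}.
Proof. by elim/quotW=> s; rewrite [_ *: _]pm_scaleE !pmod_lift_pi. Qed.

End Lift.
End PresentedModule.

Section PresentedAlgebra.
Variables (k : fieldType) (X : Type).

Inductive aterm :=
| AVar of X
| AZero
| AOne
| AAdd of aterm & aterm
| AOpp of aterm
| AMul of aterm & aterm
| AScale of k & aterm.

HB.instance Definition _ := gen_eqMixin aterm.
HB.instance Definition _ := gen_choiceMixin aterm.

Variable E : aterm -> aterm -> Prop.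

Inductive aeq : aterm -> aterm -> Prop :=
| AEbase s t : E s t -> aeq s t
| AErefl t : aeq t t
| AEsym s t : aeq s t -> aeq t s
| AEtrans s t u : aeq s t -> aeq t u -> aeq s u
| AEadd s s' t t' : aeq s s' -> aeq t t' -> aeq (AAdd s t) (AAdd s' t')
| AEopp s s' : aeq s s' -> aeq (AOpp s) (AOpp s')
| AEmul s s' t t' : aeq s s' -> aeq t t' -> aeq (AMul s t) (AMul s' t')
| AEscale c s s' : aeq s s' -> aeq (AScale c s) (AScale c s')
| AEaddA s t u : aeq (AAdd s (AAdd t u)) (AAdd (AAdd s t) u)
| AEaddC s t : aeq (AAdd s t) (AAdd t s)
| AEadd0 s : aeq (AAdd AZero s) s
| AEaddN s : aeq (AAdd (AOpp s) s) AZero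
| AEmulA s t u : aeq (AMul s (AMul t u)) (AMul (AMul s t) u)
| AEmul1l s : aeq (AMul AOne s) s
| AEmul1r s : aeq (AMul s AOne) s
| AEmulDl s t u : aeq (AMul (AAdd s t) u) (AAdd (AMul s u) (AMul t u))
| AEmulDr s t u : aeq (AMul s (AAdd t u)) (AAdd (AMul s t) (AMul s u))
| AEscaleA b c s : aeq (AScale b (AScale c s)) (AScale (b * c) s)
| AEscale1 s : aeq (AScale 1 s) s
| AEscaleDr c s t : aeq (AScale c (AAdd s t)) (AAdd (AScale c s) (AScale c t))
| AEscaleDl b c s : aeq (AScale (b + c) s) (AAdd (AScale b s) (AScale c s))
| AEscaleMl c s t : aeq (AScale c (AMul s t)) (AMul (AScale c s) t)
| AEscaleMr c s t : aeq (AScale c (AMul s t)) (AMul s (AScale c t)).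

Lemma aeq_equiv_class : equiv_class_of (fun s t => `[< aeq s t >]).
Proof.
split=> [t|s t|t s u]; first by apply/asboolP; exact: AErefl.
  by apply/asboolP/asboolP => /AEsym.
by move=> /asboolP st /asboolP tu; apply/asboolP; exact: AEtrans st tu.
Qed.
Canonical aeq_equiv := EquivRelPack aeq_equiv_class.

Definition palg : Type := {eq_quot aeq_equiv}.
HB.instance Definition _ := Choice.on palg.
HB.instance Definition _ := EqQuotient.on palg.

Lemma palgP s t : reflect (aeq s t) (\pi_palg s == \pi_palg t).
Proof. by rewrite eqmodE; exact: asboolP. Qed.

Lemma palg_eq s t : aeq s t -> \pi_palg s = \pi_palg t.
Proof. by move=> /palgP/eqP. Qed.

Lemma repr_aeq s : aeq (repr (\pi_palg s)) s.
Proof. by apply/palgP; rewrite reprK. Qed.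

Definition pa_zero : palg := \pi_palg AZero.
Definition pa_one : palg := \pi_palg AOne.
Definition pa_add (x y : palg) : palg := \pi_palg (AAdd (repr x) (repr y)).
Definition pa_opp (x : palg) : palg := \pi_palg (AOpp (repr x)).
Definition pa_mul (x y : palg) : palg := \pi_palg (AMul (repr x) (repr y)).
Definition pa_scale c (x : palg) : palg := \pi_palg (AScale c (repr x)).

Lemma pa_addE s t : pa_add (\pi_palg s) (\pi_palg t) = \pi_palg (AAdd s t).
Proof. by apply: palg_eq; apply: AEadd; exact: repr_aeq. Qed.
Lemma pa_oppE s : pa_opp (\pi_palg s) = \pi_palg (AOpp s).
Proof. by apply: palg_eq; apply: AEopp; exact: repr_aeq. Qed.
Lemma pa_mulE s t : pa_mul (\pi_palg s) (\pi_palg t) = \pi_palg (AMul s t).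
Proof. by apply: palg_eq; apply: AEmul; exact: repr_aeq. Qed.
Lemma pa_scaleE c s : pa_scale c (\pi_palg s) = \pi_palg (AScale c s).
Proof. by apply: palg_eq; apply: AEscale; exact: repr_aeq. Qed.

Lemma pa_addA : associative pa_add.
Proof.
elim/quotW=> s; elim/quotW=> t; elim/quotW=> u.
by rewrite (pa_addE t u) (pa_addE s t) !pa_addE; apply: palg_eq;
  exact: AEaddA.
Qed.
Lemma pa_addC : commutative pa_add.
Proof.
elim/quotW=> s; elim/quotW=> t.
by rewrite !pa_addE; apply: palg_eq; exact: AEaddC.
Qed.
Lemma pa_add0 : left_id pa_zero pa_add.
Proof. by elim/quotW=> s; rewrite pa_addE; apply: palg_eq; exact: AEadd0. Qed.
Lemma pa_addN : left_inverse pa_zero pa_opp pa_add.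
Proof.
by elim/quotW=> s; rewrite pa_oppE pa_addE; apply: palg_eq; exact: AEaddN.
Qed.
HB.instance Definition _ :=
  GRing.isZmodule.Build palg pa_addA pa_addC pa_add0 pa_addN.

Lemma pa_mulA : associative pa_mul.
Proof.
elim/quotW=> s; elim/quotW=> t; elim/quotW=> u.
by rewrite (pa_mulE t u) (pa_mulE s t) !pa_mulE; apply: palg_eq;
  exact: AEmulA.
Qed.
Lemma pa_mul1l : left_id pa_one pa_mul.
Proof. by elim/quotW=> s; rewrite pa_mulE; apply: palg_eq; exact: AEmul1l. Qed.
Lemma pa_mul1r : right_id pa_one pa_mul.
Proof. by elim/quotW=> s; rewrite pa_mulE; apply: palg_eq; exact: AEmul1r. Qed.
Lemma pa_mulDl : left_distributive pa_mul +%R.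
Proof.
elim/quotW=> s; elim/quotW=> t; elim/quotW=> u.
transitivity (\pi_palg (AMul (AAdd s t) u)).
  by rewrite -pa_mulE -pa_addE.
transitivity (pa_add (\pi_palg (AMul s u)) (\pi_palg (AMul t u))).
  by rewrite pa_addE; apply: palg_eq; exact: AEmulDl.
by rewrite -!pa_mulE.
Qed.
Lemma pa_mulDr : right_distributive pa_mul +%R.
Proof.
elim/quotW=> s; elim/quotW=> t; elim/quotW=> u.
transitivity (\pi_palg (AMul s (AAdd t u))).
  by rewrite -pa_mulE -pa_addE.
transitivity (pa_add (\pi_palg (AMul s t)) (\pi_palg (AMul s u))).
  by rewrite pa_addE; apply: palg_eq; exact: AEmulDr.
by rewrite -!pa_mulE.
Qed.
HB.instance Definition _ := GRing.Zmodule_isPzRing.Build palg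
  pa_mulA pa_mul1l pa_mul1r pa_mulDl pa_mulDr.

Lemma pa_scaleA b c (x : palg) :
  pa_scale b (pa_scale c x) = pa_scale (b * c) x.
Proof.
elim/quotW: x => s; rewrite (pa_scaleE c s) !pa_scaleE; apply: palg_eq.
exact: AEscaleA.
Qed.
Lemma pa_scale1 : left_id 1 pa_scale.
Proof.
by elim/quotW=> s; rewrite pa_scaleE; apply: palg_eq; exact: AEscale1.
Qed.
Lemma pa_scaleDr : right_distributive pa_scale +%R.
Proof.
move=> c; elim/quotW=> s; elim/quotW=> t.
transitivity (\pi_palg (AScale c (AAdd s t))).
  by rewrite -pa_scaleE -pa_addE.
transitivity (pa_add (\pi_palg (AScale c s)) (\pi_palg (AScale c t))).
  by rewrite pa_addE; apply: palg_eq; exact: AEscaleDr.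
by rewrite -!pa_scaleE.
Qed.
Lemma pa_scaleDl (x : palg) : {morph pa_scale^~ x : b c / b + c}.
Proof.
elim/quotW: x => s b c.
transitivity (pa_add (\pi_palg (AScale b s)) (\pi_palg (AScale c s))).
  by rewrite pa_addE pa_scaleE; apply: palg_eq; exact: AEscaleDl.
by rewrite -!pa_scaleE.
Qed.
HB.instance Definition _ := GRing.Zmodule_isLmodule.Build k palg
  pa_scaleA pa_scale1 pa_scaleDr pa_scaleDl.

Lemma palg_scaleAl c (x y : palg) : c *: (x * y) = (c *: x) * y.
Proof.
elim/quotW: x => s; elim/quotW: y => t.
transitivity (\pi_palg (AScale c (AMul s t))).
  by rewrite -pa_scaleE -pa_mulE.
transitivity (\pi_palg (AMul (AScale c s) t)).
  by apply: palg_eq; exact: AEscaleMl.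
by rewrite -pa_mulE -pa_scaleE.
Qed.
Lemma palg_scaleAr c (x y : palg) : c *: (x * y) = x * (c *: y).
Proof.
elim/quotW: x => s; elim/quotW: y => t.
transitivity (\pi_palg (AScale c (AMul s t))).
  by rewrite -pa_scaleE -pa_mulE.
transitivity (\pi_palg (AMul s (AScale c t))).
  by apply: palg_eq; exact: AEscaleMr.
by rewrite -pa_mulE -pa_scaleE.
Qed.

Definition agen (x : X) : palg := \pi_palg (AVar x).

Fixpoint aeval (B : algType k) (f : X -> B) (t : aterm) : B :=
  match t with
  | AVar x => f x
  | AZero => 0
  | AOne => 1
  | AAdd s t => aeval f s + aeval f t
  | AOpp s => - aeval f s
  | AMul s t => aeval f s * aeval f t
  | AScale c s => c *: aeval f s
  end.

Lemma palg_ind (P : palg -> Prop) :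
  P 0 -> P 1 -> (forall x, P (agen x)) ->
  (forall u v, P u -> P v -> P (u + v)) ->
  (forall u v, P u -> P v -> P (u * v)) ->
  (forall c u, P u -> P (c *: u)) -> forall u, P u.
Proof.
move=> P0 P1 Pg PD PM PZ; elim/quotW; elim=> //=.
- by move=> s Ps t Pt; rewrite -pa_addE; exact: PD.
- move=> s Ps; rewrite -pa_oppE (_ : pa_opp _ = - \pi_palg s) // -scaleN1r.
  exact: PZ.
- by move=> s Ps t Pt; rewrite -pa_mulE; exact: PM.
- by move=> c s Ps; rewrite -pa_scaleE; exact: PZ.
Qed.

Section Lift.
Variables (B : algType k) (f : X -> B).

Definition palg_lift (u : palg) : B := aeval f (repr u).

Hypothesis fE : forall s t, E s t -> aeval f s = aeval f t.

Lemma aeval_aeq s t : aeq s t -> aeval f s = aeval f t.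
Proof.
elim=> //=.
- by move=> ? ? ? _ -> _ ->.
- by move=> ? ? ? ? _ -> _ ->.
- by move=> ? ? _ ->.
- by move=> ? ? ? ? _ -> _ ->.
- by move=> ? ? ? _ ->.
- by move=> *; rewrite addrA.
- by move=> *; rewrite addrC.
- by move=> *; rewrite add0r.
- by move=> *; rewrite addNr.
- by move=> *; rewrite mulrA.
- by move=> *; rewrite mul1r.
- by move=> *; rewrite mulr1.
- by move=> *; rewrite mulrDl.
- by move=> *; rewrite mulrDr.
- by move=> *; rewrite scalerA.
- by move=> *; rewrite scale1r.
- by move=> *; rewrite scalerDr.
- by move=> *; rewrite scalerDl.
- by move=> *; rewrite scalerAl.
- by move=> *; rewrite scalerAr.
Qed.

Lemma palg_lift_pi t : palg_lift (\pi_palg t) = aeval f t.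
Proof. by apply: aeval_aeq; exact: repr_aeq. Qed.
Lemma palg_lift_gen x : palg_lift (agen x) = f x.
Proof. by rewrite palg_lift_pi. Qed.
Lemma palg_lift1 : palg_lift 1 = 1.
Proof. exact: (palg_lift_pi AOne). Qed.
Lemma palg_liftD : {morph palg_lift : u v / u + v}.
Proof.
by elim/quotW=> s; elim/quotW=> t; rewrite [_ + _]pa_addE !palg_lift_pi.
Qed.
Lemma palg_liftM : {morph palg_lift : u v / u * v}.
Proof.
by elim/quotW=> s; elim/quotW=> t; rewrite [_ * _]pa_mulE !palg_lift_pi.
Qed.
Lemma palg_liftZ c : {morph palg_lift : u / c *: u}.
Proof. by elim/quotW=> s; rewrite [_ *: _]pa_scaleE !palg_lift_pi. Qed.

End Lift.
End PresentedAlgebra.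

Section Tensor.
Variables (K : pzRingType) (M N : zmodType).
Variables (S : Type) (ra : M -> S -> M) (la : S -> N -> N).
Variables (G : Type) (io : G -> K) (aM : G -> M -> M) (aN : G -> N -> N).

Let pure (m : M) (n : N) : mterm K (M * N) := MVar K (m, n).

(* [tensor] is M (x)_S N, for [ra] the right action of S on M and [la] the    *)
(* left action of S on N, as a left K-module: the ring K is generated by      *)
(* elements [io g], and [io g] acts by m (x) n |-> aM g m (x) aN g n.         *)
Inductive tensor_rel : mterm K (M * N) -> mterm K (M * N) -> Prop :=
| TRaddl m m' n :
    tensor_rel (pure (m + m') n) (MAdd (pure m n) (pure m' n))
| TRaddr m n n' :
    tensor_rel (pure m (n + n')) (MAdd (pure m n) (pure m n'))
| TRbal m s n : tensor_rel (pure (ra m s) n) (pure m (la s n))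
| TRact g m n :
    tensor_rel (pure (aM g m) (aN g n)) (MScale (io g) (pure m n)).

Definition tensor : lmodType K := pmod tensor_rel.

End Tensor.

Section TensorField.
Variable k : fieldType.

Definition tens (V W : lmodType k) : lmodType k :=
  @tensor k V W k (fun v c => c *: v) (fun c w => c *: w)
    k id (fun c v => c *: v) (fun _ w => w).

Definition tpure (V W : lmodType k) (v : V) (w : W) : tens V W :=
  pgen _ (v, w).

Section Bilinear.
Variables V W U : lmodType k.
Implicit Type b : V -> W -> U.

Record bilin b : Prop := Bilin {
  bilinDl : forall v v' w, b (v + v') w = b v w + b v' w;
  bilinDr : forall v w w', b v (w + w') = b v w + b v w';
  bilinZl : forall c v w, b (c *: v) w = c *: b v w;
  bilinZr : forall c v w, b v (c *: w) = c *: b v w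
}.

Definition tlift b : tens V W -> U := pmod_lift (fun vw => b vw.1 vw.2).

Lemma tlift_rel b : bilin b -> forall s t,
  tensor_rel (fun v c => c *: v) (fun c w => c *: w)
    id (fun c v => c *: v) (fun _ w => w) s t ->
  meval (fun vw : V * W => b vw.1 vw.2) s =
  meval (fun vw : V * W => b vw.1 vw.2) t.
Proof.
move=> bb s t [v v' w|v w w'|v c w|c v w] /=.
- exact: bilinDl.
- exact: bilinDr.
- by rewrite bilinZl // bilinZr.
- exact: bilinZl.
Qed.

Lemma tlift_pure b : bilin b -> forall v w, tlift b (tpure v w) = b v w.
Proof. by move=> /tlift_rel bE v w; rewrite /tlift pmod_lift_gen. Qed.
Lemma tliftD b : bilin b -> {morph tlift b : x y / x + y}.
Proof. by move=> /tlift_rel bE; exact: pmod_liftD. Qed.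
Lemma tliftZ b : bilin b -> forall c, {morph tlift b : x / c *: x}.
Proof. by move=> /tlift_rel bE; exact: pmod_liftZ. Qed.

Lemma tlift0 b : bilin b -> tlift b 0 = 0.
Proof. by move=> bb; rewrite -(scale0r 0) tliftZ // scale0r. Qed.

End Bilinear.

Lemma tpure_bilin V W : bilin (@tpure V W).
Proof.
have tDl (v v' : V) (w : W) : tpure (v + v') w = tpure v w + tpure v' w.
  exact: (pmod_rel (TRaddl _ _ _ _ _ _ _ _)).
have tDr (v : V) (w w' : W) : tpure v (w + w') = tpure v w + tpure v w'.
  exact: (pmod_rel (TRaddr _ _ _ _ _ _ _ _)).
have tZl c (v : V) (w : W) : tpure (c *: v) w = c *: tpure v w.
  exact: (pmod_rel (TRact _ _ id (fun c v => c *: v) (fun _ w => w) c v w)).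
have tZr c (v : V) (w : W) : tpure v (c *: w) = c *: tpure v w.
  rewrite -tZl; symmetry.
  exact: (pmod_rel (TRbal (fun v c => c *: v) (fun c w => c *: w)
    id (fun c v => c *: v) (fun _ w => w) v c w)).
by split.
Qed.

Lemma tens_ind V W (P : tens V W -> Prop) :
  P 0 -> (forall v w, P (tpure v w)) ->
  (forall x y, P x -> P y -> P (x + y)) -> forall x, P x.
Proof.
move=> P0 Pp PD x; suff: forall c, P (c *: x) by move/(_ 1); rewrite scale1r.
elim/pmod_ind: x => [|[v w]|x y Px Py|b x Px] c.
- by rewrite scaler0.
- by rewrite -[pgen _ _]/(tpure v w) -(bilinZl (tpure_bilin _ _)).
- by rewrite scalerDr; exact: PD.
- by rewrite scalerA.
Qed.

End TensorField.

Section TensorAlgebra.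
Variables (k : fieldType) (A B : algType k).

Definition talg : Type := tens A B.
HB.instance Definition _ := GRing.Lmodule.on talg.

Definition tpair (a : A) (b : B) : talg := tpure a b.

Definition tmul_pure (a : A) (b : B) : talg -> talg :=
  tlift (fun c d => tpair (a * c) (b * d)).
Definition tmul (x y : talg) : talg := tlift (fun a b => tmul_pure a b y) x.

Let tpB := tpure_bilin A B.

Lemma tmul_pure_bilin a b :
  bilin (fun (c : A) (d : B) => tpair (a * c) (b * d)).
Proof.
split=> [c c' d|c d d'|e c d|e c d]; rewrite /tpair.
- by rewrite mulrDr; exact: bilinDl.
- by rewrite mulrDr; exact: bilinDr.
- by rewrite -scalerAr; exact: bilinZl.
- by rewrite -scalerAr; exact: bilinZr.
Qed.
Let tmB := tmul_pure_bilin.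

Lemma tmul_bilin y : bilin (fun (a : A) (b : B) => tmul_pure a b y).
Proof.
elim/tens_ind: y => [|c d|y z [yDl yDr yZl yZr] [zDl zDr zZl zZr]].
- by split=> *; rewrite /tmul_pure !tlift0 ?addr0 ?scaler0.
- split=> [a a' b|a b b'|e a b|e a b]; rewrite /tmul_pure !tlift_pure // /tpair.
  + by rewrite mulrDl; exact: bilinDl.
  + by rewrite mulrDl; exact: bilinDr.
  + by rewrite -scalerAl; exact: bilinZl.
  + by rewrite -scalerAl; exact: bilinZr.
have tD a b : tmul_pure a b (y + z) = tmul_pure a b y + tmul_pure a b z.
  exact: tliftD.
split=> [a a' b|a b b'|e a b|e a b]; rewrite !tD.
- by rewrite yDl zDl addrACA.
- by rewrite yDr zDr addrACA.
- by rewrite yZl zZl scalerDr.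
- by rewrite yZr zZr scalerDr.
Qed.
Let tmlB := tmul_bilin.

Lemma tmulE a b c d : tmul (tpair a b) (tpair c d) = tpair (a * c) (b * d).
Proof. by rewrite /tmul tlift_pure // /tmul_pure tlift_pure. Qed.

Let tmul_tpure (a c : A) (b d : B) :
  tmul (tpure a b) (tpure c d) = tpure (a * c) (b * d).
Proof. exact: tmulE. Qed.

Lemma tmulDl : left_distributive tmul +%R.
Proof. by move=> x y z; rewrite /tmul; exact: tliftD. Qed.

Lemma tmulZl e x y : tmul (e *: x) y = e *: tmul x y.
Proof. by rewrite /tmul; exact: tliftZ. Qed.

Lemma tmulDr : right_distributive tmul +%R.
Proof.
move=> x y z; elim/tens_ind: x => [|a b|x x' IH IH'].
- by rewrite /tmul !tlift0 // addr0.
- by rewrite /tmul !tlift_pure //; exact: tliftD.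
- by rewrite !tmulDl IH IH' addrACA.
Qed.

Lemma tmulZr e x y : tmul x (e *: y) = e *: tmul x y.
Proof.
elim/tens_ind: x => [|a b|x x' IH IH'].
- by rewrite /tmul !tlift0 // scaler0.
- by rewrite /tmul !tlift_pure //; exact: tliftZ.
- by rewrite !tmulDl IH IH' scalerDr.
Qed.

Lemma tmul0l x : tmul 0 x = 0.
Proof. by have := tmulZl 0 0 x; rewrite !scale0r. Qed.
Lemma tmul0r x : tmul x 0 = 0.
Proof. by have := tmulZr 0 x 0; rewrite !scale0r. Qed.

Lemma tmulA : associative tmul.
Proof.
move=> x y z; elim/tens_ind: x => [|a b|x x' IH IH']; first by rewrite !tmul0l.
  elim/tens_ind: y => [|c d|y y' IH IH']; first by rewrite tmul0r !tmul0l tmul0r.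
    elim/tens_ind: z => [|e f|z z' IH IH']; first by rewrite !tmul0r.
      by rewrite !tmul_tpure !mulrA.
    by rewrite !tmulDr IH IH'.
  by rewrite !(tmulDl, tmulDr) IH IH'.
by rewrite !tmulDl IH IH'.
Qed.

Lemma tmul1l : left_id (tpair 1 1) tmul.
Proof.
elim/tens_ind=> [|a b|x y IHx IHy]; first by rewrite tmul0r.
  by rewrite tmul_tpure !mul1r.
by rewrite tmulDr IHx IHy.
Qed.

Lemma tmul1r : right_id (tpair 1 1) tmul.
Proof.
elim/tens_ind=> [|a b|x y IHx IHy]; first by rewrite tmul0l.
  by rewrite tmul_tpure !mulr1.
by rewrite tmulDl IHx IHy.
Qed.

HB.instance Definition _ :=
  GRing.Zmodule_isPzRing.Build talg tmulA tmul1l tmul1r tmulDl tmulDr.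

Lemma tpairM a b c d : tpair a b * tpair c d = tpair (a * c) (b * d).
Proof. exact: tmulE. Qed.

End TensorAlgebra.

Section ConverseAlgebra.
Variables (k : fieldType) (A : algType k).

HB.instance Definition _ := GRing.Lmodule.copy (A^c) A.
Fact conv_scaleAl (c : k) (x y : A^c) : c *: (x * y) = (c *: x : A^c) * y.
Proof. exact: (@scalerAr k A c y x). Qed.
Fact conv_scaleAr (c : k) (x y : A^c) : c *: (x * y) = x * (c *: y : A^c).
Proof. exact: (@scalerAl k A c y x). Qed.
HB.instance Definition _ :=
  GRing.Lmodule_isLalgebra.Build k (A^c) conv_scaleAl.
HB.instance Definition _ :=
  GRing.Lalgebra_isAlgebra.Build k (A^c) conv_scaleAr.

End ConverseAlgebra.

Definition ring_hom (A B : pzRingType) (h : A -> B) : Prop :=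
  zmod_morphism h /\ monoid_morphism h.

Definition kpow (k : fieldType) (p : nat) := {ffun 'I_p -> k^o}.

(* The structural maps are homomorphisms of k-algebras, so that k acts        *)
(* centrally on S and R (x)_k S^op makes sense.                               *)
Record pAlg (k : fieldType) (p : nat) := PAlg {
  pcarrier :> algType k;
  pin : kpow k p -> pcarrier;
  pout : pcarrier -> kpow k p;
  pin_hom : ring_hom pin;
  pinZ : scalable pin;
  pout_hom : ring_hom pout;
  poutZ : scalable pout;
  pinK : cancel pin pout
}.

Section PointedAlgebras.
Variables (k : fieldType) (p : nat).
Implicit Types S T U : pAlg k p.

(* Such an h is k-linear, since it commutes with the maps from k^p.           *)
Definition pmor S T (h : S -> T) : Prop :=
  [/\ ring_hom h, forall v, h (pin S v) = pin T v
    & forall x, pout (h x) = pout x].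

Definition Mor S T := {h : S -> T | pmor h}.

Lemma pmor_comp S T U (g : T -> U) (h : S -> T) :
  pmor g -> pmor h -> pmor (g \o h).
Proof.
move=> [[gB [g1 gM]] gi go] [[hB [h1 hM]] hi ho]; split=> [|v|x] /=.
- split=> [x y|] /=; first by rewrite hB gB.
  by split=> [|x y] /=; rewrite ?h1 ?hM.
- by rewrite hi gi.
- by rewrite go ho.
Qed.

Definition mor_comp S T U (g : Mor T U) (h : Mor S T) : Mor S U :=
  exist _ _ (pmor_comp (svalP g) (svalP h)).

Definition idem S (i : 'I_p) : S := pin S [ffun j => (j == i)%:R].

Definition radical S (x : S) : Prop := pout x = 0.

(* The ideal I(S)^n, for [0 < n] only.                                        *)
Definition radical_pow S (n : nat) (x : S) : Prop :=
  exists (m : nat) (y : 'I_m -> 'I_n -> S),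
    (forall a b, radical (y a b)) /\ x = \sum_a \prod_b y a b.

Definition findim (V : lmodType k) : Prop :=
  exists (d : nat) (b : 'I_d -> V), forall x : V,
  exists c : 'I_d -> k, x = \sum_i c i *: b i.

Definition radical_pow0 S (n : nat) : Prop :=
  forall x : S, radical_pow n x -> x = 0.

(* Artinian and complete for the I(S)-adic topology is equivalent to finite   *)
(* dimensional with nilpotent radical: I(S) is then the Jacobson radical.     *)
Definition in_a S : Prop :=
  findim S /\ exists2 n, (0 < n)%N & radical_pow0 S n.

Definition in_an (n : nat) S : Prop := in_a S /\ radical_pow0 S n.

Record aObj := AObj { aalg :> pAlg k p; aalgP : in_a aalg }.

(* The canonical map S -> lim_n S/I(S)^n is bijective.                        *)
Definition adic_complete S : Prop :=
  (forall x : S, (forall n, radical_pow n.+1 x) -> x = 0) /\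
  (forall u : nat -> S, (forall n, radical_pow n.+1 (u n.+1 - u n)) ->
   exists x, forall n, radical_pow n.+1 (x - u n)).

(* Up to isomorphism, Q is the pointed algebra S/I(S)^n.                      *)
Definition is_radical_quot (n : nat) S Q : Prop :=
  exists q : Mor S Q, (forall y, exists x, sval q x = y) /\
    forall x, sval q x = 0 <-> radical_pow n x.

Definition in_hat S : Prop :=
  adic_complete S /\
  forall n, (0 < n)%N -> exists2 Q, is_radical_quot n S Q & in_an n Q.

End PointedAlgebras.

Section Peirce.
Variables (k : fieldType) (p : nat) (S : pAlg k p) (i j : 'I_p).

Definition peirce_pred : {pred S} :=
  fun x => `[< exists y, x = idem S i * y * idem S j >].

Record peirce := Peirce { peirce_val : S; _ : peirce_val \in peirce_pred }.
HB.instance Definition _ := [isSub for peirce_val].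
HB.instance Definition _ := [Choice of peirce by <:].

Lemma peirce_closed : subsemimod_closed peirce_pred.
Proof.
split; first split.
- by apply/asboolP; exists 0; rewrite mulr0 mul0r.
- move=> _ _ /asboolP[x ->] /asboolP[y ->]; apply/asboolP; exists (x + y).
  by rewrite mulrDr mulrDl.
- move=> c _ /asboolP[x ->]; apply/asboolP; exists (c *: x).
  by rewrite -scalerAr -scalerAl.
Qed.
HB.instance Definition _ :=
  GRing.SubChoice_isSubLmodule.Build k S peirce_pred peirce peirce_closed.

Lemma peirce_projP (y : S) : idem S i * y * idem S j \in peirce_pred.
Proof. by apply/asboolP; exists y. Qed.

Definition peirce_proj (y : S) : peirce := Peirce (peirce_projP y).

End Peirce.

Section Ext.
Variables (k : fieldType) (R : algType k).

Definition projective (P : lmodType R) : Prop :=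
  forall (X Y : lmodType R) (q : {linear X -> Y}) (f : {linear P -> Y}),
    (forall y, exists x, q x = y) ->
    exists g : {linear P -> X}, forall x, q (g x) = f x.

Record projres (M : lmodType R) := ProjRes {
  pr_mod :> nat -> lmodType R;
  pr_d : forall n, {linear pr_mod n.+1 -> pr_mod n};
  pr_aug : {linear pr_mod 0 -> M};
  pr_proj : forall n, projective (pr_mod n);
  pr_aug_surj : forall y, exists x, pr_aug x = y;
  pr_exact0 : forall x, pr_aug x = 0 <-> exists y, pr_d 0 y = x;
  pr_exact : forall n x, pr_d n x = 0 <-> exists y, pr_d n.+1 y = x
}.

Definition cocycle (M N : lmodType R) (P : projres M) n (f : P n -> N) : Prop :=
  forall x, f (pr_d P n x) = 0.

Definition coboundary (M N : lmodType R) (P : projres M) n :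
    (P n -> N) -> Prop :=
  match n with
  | 0 => fun f => forall x, f x = 0
  | n'.+1 => fun f => exists g : {linear P n' -> N},
      forall x, f x = g (pr_d P n' x)
  end.

(* Ext^n_R(M, N), as the n-th cohomology of Hom_R(P, N), is spanned over k    *)
(* by finitely many classes.                                                  *)
Definition ext_findim (n : nat) (M N : lmodType R) : Prop :=
  exists (P : projres M) (d : nat) (b : 'I_d -> {linear P n -> N}),
    (forall i, cocycle (b i)) /\
    forall f : {linear P n -> N}, cocycle f ->
    exists c : 'I_d -> k,
      coboundary (fun x => f x - \sum_i (c i)%:A *: b i x).

End Ext.

Section RestrictScalars.
Variables (k : fieldType) (R : algType k) (M : lmodType R).

Definition resk : Type := M.
HB.instance Definition _ := GRing.Zmodule.on resk.

Definition resk_scale (c : k) (x : resk) : resk := (c%:A : R) *: (x : M).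
Fact resk_scaleA b c x : resk_scale b (resk_scale c x) = resk_scale (b * c) x.
Proof. by rewrite /resk_scale scalerA -scalerAl mul1r scalerA. Qed.
Fact resk_scale1 : left_id 1 resk_scale.
Proof. by move=> x; rewrite /resk_scale !scale1r. Qed.
Fact resk_scaleDr : right_distributive resk_scale +%R.
Proof. by move=> c x y; exact: scalerDr. Qed.
Fact resk_scaleDl x : {morph resk_scale^~ x : b c / b + c}.
Proof. by move=> b c; rewrite /resk_scale scalerDl; exact: scalerDl. Qed.
HB.instance Definition _ := GRing.Zmodule_isLmodule.Build k resk
  resk_scaleA resk_scale1 resk_scaleDr resk_scaleDl.

End RestrictScalars.

Section Deformations.
Variables (k : fieldType) (p : nat) (R : algType k).
Implicit Types S : pAlg k p.

Notation bimod S := (lmodType (talg R (S : algType k)^c)).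

Definition lact S (L : bimod S) (r : R) (x : L) : L :=
  tpair r (1 : S^c) *: x.
Definition ract S (L : bimod S) (x : L) (s : S) : L :=
  tpair (1 : R) (s : S^c) *: x.

(* The left R-module L (x)_S k_i, with S acting on k_i = k through g.         *)
Definition fiber S (L : bimod S) (i : 'I_p) : lmodType R :=
  @tensor R L k^o S (@ract S L) (fun s c => pout s i * c)
    R id (@lact S L) (fun _ c => c).
Definition fpure S (L : bimod S) (i : 'I_p) (x : L) (c : k) : fiber L i :=
  pgen _ (x, c : k^o).

Definition base_change S S' (f : S -> S') (L : bimod S) : bimod S' :=
  @tensor (talg R S'^c) L S' S (@ract S L) (fun s t => f s * t)
    (R * S') (fun g => tpair g.1 (g.2 : S'^c))
    (fun g x => lact g.1 x) (fun g t => t * g.2).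
Definition bpure S S' (f : S -> S') (L : bimod S) (x : L) (t : S') :
  base_change f L := pgen _ (x, t).

Variable M : 'I_p -> lmodType R.

(* The direct sum of the M_i (x)_k S_ij; s in S maps the summand (i, j) to    *)
(* the summand (i, l) by m (x) x |-> m (x) x s e_l.                           *)
Definition free_mod S := forall i j : 'I_p, tens (resk (M i)) (peirce S i j).
Definition free_add S (t u : free_mod S) : free_mod S :=
  fun i j => t i j + u i j.
Definition free_act S (t : free_mod S) (s : S) : free_mod S :=
  fun i l => \sum_j tlift (fun (m : resk (M i)) (x : peirce S i j) =>
    tpure m (peirce_proj i l (val x * s))) (t i j).

Record lifting S := Lifting {
  lmod :> bimod S;
  leta : forall i, {linear fiber lmod i -> M i};
  leta_bij : forall i, bijective (leta i);
  lfree : exists f : lmod -> free_mod S,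
    [/\ forall x y, f (x + y) = free_add (f x) (f y),
        forall x s, f (ract x s) = free_act (f x) s
      & bijective f]
}.

(* The square for eta' is checked on the generators x (x) c of L (x)_S k_i.   *)
Definition lequiv S (L L' : lifting S) : Prop :=
  exists t : {linear L -> L'}, bijective t /\
    forall i x c, leta L' i (fpure i (t x) c) = leta L i (fpure i x c).

Definition DefF S := {C : lifting S -> Prop | exists L, C = lequiv L}.

(* L' is equivalent to the lifting L (x)_S S' with the isomorphisms           *)
(* (L (x)_S S') (x)_S' k_i = L (x)_S k_i -> M_i.                              *)
Definition is_pushforward S S' (f : S -> S') (L : lifting S) (L' : lifting S')
    : Prop :=
  exists t : {linear base_change f L -> L'}, bijective t /\
    forall i x y c, leta L' i (fpure i (t (bpure f x y)) c) =
                    leta L i (fpure i x (pout y i * c)).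

(* The image under Def(f) of the class C, as a set of liftings to S'.         *)
Definition def_map S S' (f : Mor S S') (C : DefF S) : lifting S' -> Prop :=
  fun L' => exists2 L, sval C L & is_pushforward (sval f) L L'.

Definition def_natural (H : pAlg k p)
    (rho : forall S : aObj k p, Mor H S -> DefF S) : Prop :=
  forall (S S' : aObj k p) (f : Mor S S') (h : Mor H S),
    sval (rho S' (mor_comp f h)) = def_map f (rho S h).

Definition def_smooth (H : pAlg k p)
    (rho : forall S : aObj k p, Mor H S -> DefF S) : Prop :=
  forall (S S' : aObj k p) (f : Mor S S'), (forall y, exists x, sval f x = y) ->
  forall (h' : Mor H S') (C : DefF S), sval (rho S' h') = def_map f C ->
  exists2 h : Mor H S, mor_comp f h = h' & rho S h = C.

Definition is_hull (H : pAlg k p) : Prop :=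
  in_hat H /\
  exists rho : forall S : aObj k p, Mor H S -> DefF S,
    [/\ def_natural rho, def_smooth rho
      & forall S : aObj k p, in_an 2 S -> bijective (rho S)].

End Deformations.

Section AffineScheme.
Variable k : fieldType.

Definition is_alg_hom (A B : algType k) (f : A -> B) : Prop :=
  ring_hom f /\ scalable f.

Definition alg_hom (A B : algType k) := {f : A -> B | is_alg_hom f}.

Lemma is_alg_hom_comp (A B C : algType k) (g : B -> C) (f : A -> B) :
  is_alg_hom g -> is_alg_hom f -> is_alg_hom (g \o f).
Proof.
move=> [[gB [g1 gM]] gZ] [[fB [f1 fM]] fZ]; split=> [|c x] /=; last first.
  by rewrite fZ gZ.
split=> [x y|] /=; first by rewrite fB gB.
by split=> [|x y] /=; rewrite ?f1 ?fM.
Qed.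

Definition alg_comp (A B C : algType k) (g : alg_hom B C) (f : alg_hom A B) :
  alg_hom A C := exist _ _ (is_alg_hom_comp (svalP g) (svalP f)).

Definition talg_map (A A' B B' : algType k) (f : A -> A') (g : B -> B') :
    talg A B -> talg A' B' :=
  tlift (fun a b => tpair (f a) (g b)).

Variable p : nat.
Implicit Types H S : pAlg k p.

(* The base change to A of the structural map S -> k^p.                       *)
Definition pout_tens S (A : algType k) (t : talg S A) (i : 'I_p) : A :=
  tlift (fun (s : S) (a : A) => pout s i *: a) t.

(* The A-points of the functor Mor(H, S): morphisms from H to the base change *)
(* A^p -> S (x)_k A -> A^p.                                                   *)
Definition is_apoint H S (A : comAlgType k) (h : H -> talg S A) : Prop :=
  [/\ ring_hom h, forall v, h (pin H v) = tpair (pin S v) 1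
    & forall x i, pout_tens (h x) i = (pout x i)%:A].

Definition apoint H S (A : comAlgType k) :=
  {h : H -> talg S A | is_apoint h}.

(* An affine scheme over k is a commutative k-algebra B, or the functor       *)
(* A |-> Hom_k(B, A) that it represents. A structure of affine scheme on the  *)
(* set Mor(H, S) identifies this functor with the functor of points of        *)
(* Mor(H, S), compatibly with a bijection from the k-points to Mor(H, S).     *)
Record affine_structure H S := AffineStructure {
  coord : comAlgType k;
  apt : forall A : comAlgType k, alg_hom coord A -> apoint H S A;
  apt_bij : forall A, bijective (@apt A);
  apt_nat : forall (A A' : comAlgType k) (g : alg_hom A A')
    (f : alg_hom coord A) (x : H),
    sval (apt (alg_comp g f)) x = talg_map id (sval g) (sval (apt f) x);
  kpt : alg_hom coord k^o -> Mor H S;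
  kpt_bij : bijective kpt;
  kptE : forall (f : alg_hom coord k^o) (x : H),
    sval (@apt k^o f) x = tpair (sval (kpt f) x) 1
}.

(* Composition with f : S -> S' is a morphism of affine schemes from          *)
(* Mor(H, S) to Mor(H, S').                                                   *)
Definition affine_morphism H S S' (X : affine_structure H S)
    (X' : affine_structure H S') (f : Mor S S') : Prop :=
  exists u : alg_hom (coord X') (coord X),
    forall (A : comAlgType k) (g : alg_hom (coord X) A) (x : H),
      sval (apt (alg_comp g u)) x = talg_map (sval f) id (sval (apt g) x).

End AffineScheme.

(* A total order on a finite set of arrows amounts to indexing them by 'I_m,  *)
(* in increasing order.                                                       *)
Record oquiver (p : nat) := OQuiver {
  arrows : nat;
  src : 'I_arrows -> 'I_p;
  tgt : 'I_arrows -> 'I_p;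
  oq_succ : forall a b : 'I_arrows, b = a.+1 :> nat -> tgt a = src b;
  oq_nonempty : (0 < p)%N;
  oq_connected : forall u v, connect
    (fun u v => [exists a, ((src a == u) && (tgt a == v)) ||
                           ((src a == v) && (tgt a == u))]) u v
}.

Section QuiverAlgebra.
Variables (k : fieldType) (p : nat) (G : oquiver p).

Notation term := (aterm k ('I_p + 'I_(arrows G))).
Definition qe (i : 'I_p) : term := AVar k (inl i).
Definition qx (a : 'I_(arrows G)) : term := AVar k (inr a).

(* QRx puts the generator x_a in e_(tgt a) k[Gamma] e_(src a).                *)
Inductive quiver_rel : term -> term -> Prop :=
| QRidem i j : quiver_rel (AMul (qe i) (qe j)) (if i == j then qe i else AZero _ _)
| QRone : quiver_rel (foldr (fun i t => AAdd (qe i) t) (AZero _ _) (enum 'I_p))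
    (AOne _ _)
| QRx a : quiver_rel (AMul (AMul (qe (tgt a)) (qx a)) (qe (src a))) (qx a)
| QRzero (a b : 'I_(arrows G)) : ~~ (a < b)%N -> quiver_rel (AMul (qx b) (qx a)) (AZero _ _).

Definition qalg : Type := palg quiver_rel.
HB.instance Definition _ := GRing.Lmodule.on qalg.
HB.instance Definition _ := GRing.PzRing.on qalg.

Definition qaug_gen (i : 'I_p) (g : 'I_p + 'I_(arrows G)) : k^o :=
  if g is inl j then (i == j)%:R else 0.

Lemma qaug_rel i s t : quiver_rel s t ->
  aeval (qaug_gen i) s = aeval (qaug_gen i) t.
Proof.
case=> [j l||a|a b _] /=.
- have [<-|jl] /= := eqVneq j l.
    by case: eqP => _; rewrite ?mulr1 ?mulr0.
  have [ij|] := eqVneq i j; last by rewrite mul0r.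
  by rewrite ij (negbTE jl) mulr0.
- transitivity (\sum_(j <- enum 'I_p) (i == j)%:R : k^o).
    by elim: (enum _) => [|j s' IH] /=; rewrite ?big_nil // big_cons IH.
  rewrite big_enum (bigD1 i) //= eqxx big1 ?addr0 // => j /negbTE.
  by rewrite eq_sym => ->.
- by rewrite mulr0 mul0r.
- by rewrite mulr0.
Qed.

Fact qalg_neq0 : (1 : qalg) != 0.
Proof.
pose i0 : 'I_p := Ordinal (oq_nonempty G); have qr := @qaug_rel i0.
apply/eqP => e10; have /eqP[] := oner_neq0 k.
transitivity (palg_lift (qaug_gen i0) (1 : palg quiver_rel)).
  by rewrite (palg_lift1 qr).
rewrite (_ : (1 : palg quiver_rel) = 0) //.
by have := palg_liftZ qr 0 0; rewrite !scale0r.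
Qed.
HB.instance Definition _ := GRing.PzSemiRing_isNonZero.Build qalg qalg_neq0.
HB.instance Definition _ := GRing.Lmodule_isLalgebra.Build k qalg
  (@palg_scaleAl k _ quiver_rel).
HB.instance Definition _ := GRing.Lalgebra_isAlgebra.Build k qalg
  (@palg_scaleAr k _ quiver_rel).

Definition qidem (i : 'I_p) : qalg := agen quiver_rel (inl i).

Definition qin (v : kpow k p) : qalg := \sum_i (v i : k) *: qidem i.
Definition qout (x : qalg) : kpow k p := [ffun i => palg_lift (qaug_gen i) x].

Lemma qidemM i j : qidem i * qidem j = if i == j then qidem i else 0.
Proof.
have /AEbase/palg_eq := QRidem i j; rewrite -pa_mulE.
by case: (i == j).
Qed.

Lemma qidem_sum : \sum_i qidem i = 1.
Proof.
have /AEbase/palg_eq e1 := QRone; rewrite -[RHS]e1 -big_enum /=.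
elim: (enum _) => [|i s IH] /=; first by rewrite big_nil.
by rewrite big_cons IH -pa_addE.
Qed.

Lemma qin_hom : ring_hom qin.
Proof.
split=> [u v|].
  by rewrite /qin -sumrB; apply: eq_bigr => i _; rewrite !ffunE scalerBl.
split=> [|u v].
  by rewrite -qidem_sum; apply: eq_bigr => i _; rewrite ffunE scale1r.
rewrite /qin mulr_suml; apply: eq_bigr => i _.
rewrite mulr_sumr (bigD1 i) //= big1 => [|j /negbTE ji]; last first.
  by rewrite -scalerAl -scalerAr qidemM eq_sym ji !scaler0.
by rewrite addr0 -scalerAl -scalerAr qidemM eqxx scalerA ffunE.
Qed.

Lemma qinZ : scalable qin.
Proof.
move=> c v; rewrite /qin scaler_sumr; apply: eq_bigr => i _.
by rewrite ffunE scalerA.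
Qed.

Lemma qout_hom : ring_hom qout.
Proof.
split=> [x y|].
  apply/ffunP => i; rewrite !ffunE -[- y]scaleN1r.
  have qr := @qaug_rel i.
  by rewrite (palg_liftD qr) (palg_liftZ qr) scaleN1r.
split=> [|x y]; apply/ffunP => i; rewrite !ffunE.
  exact: palg_lift1 (@qaug_rel i).
exact: (palg_liftM (@qaug_rel i)).
Qed.

Lemma qoutZ : scalable qout.
Proof.
move=> c x; apply/ffunP => i; rewrite !ffunE.
exact: (palg_liftZ (@qaug_rel i)).
Qed.

Lemma qinK : cancel qin qout.
Proof.
move=> v; apply/ffunP => i; rewrite ffunE.
have qr := @qaug_rel i.
have q0 : palg_lift (qaug_gen i) (0 : palg quiver_rel) = 0.
  by have := palg_liftZ qr 0 0; rewrite !scale0r.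
rewrite /qin (big_morph _ (palg_liftD qr) q0) (bigD1 i) //= big1 => [|j ji].
  rewrite addr0 (palg_liftZ qr) (palg_lift_gen qr) /= eqxx.
  exact: mulr1.
rewrite (palg_liftZ qr) (palg_lift_gen qr) /= eq_sym (negbTE ji).
exact: mulr0.
Qed.

Definition quiver_alg : pAlg k p :=
  PAlg qin_hom qinZ qout_hom qoutZ qinK.

End QuiverAlgebra.

Arguments apt {k p H S} _ {A} _.

(* Main.v *)
Require Import Defs.
From HB Require Import structures.
From mathcomp Require Import all_boot all_order all_algebra.
From mathcomp Require Import boolp.
Set Implicit Arguments.
Unset Strict Implicit.
Unset Printing Implicit Defensive.
Import GRing.Theory.
Local Open Scope ring_scope.

(** Since [S] has finite dimension, morphisms to [S] can be described by
    coordinates. Choose a basis [b] of [S] with dual linear forms [phi]. An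
    A-point of Mor(H, S) is a map [h : H -> S (x) A], and it is the same thing
    as its family of coordinates, the elements (phi_j (x) A)(h x) of [A], for
    [x] in [H] and [j] an index of the basis. That [h] is a ring homomorphism
    compatible with the maps from and to k^p is a system of polynomial
    equations with coefficients in [k] in these coordinates, since the
    structure constants of [S] lie in [k]. So the functor of points is
    represented by the commutative algebra on generators X_(x, j) subject to
    these equations.

    Writing the equations down can be avoided. Start from the free algebra on
    the symbols X_(x, j), and divide by all relations that are satisfied by the
    coordinates of every A-point, for every commutative [A]; this is
    [coord_ring]. By construction its elements are separated by evaluation at
    points ([point_eval_sep]), and since [S (x) -] only takes finitely many
    coordinates, so are the elements of [S (x) coord_ring] ([talg_sep]). The
    generic map, that sends [x] to the sum of the b_j (x) X_(x, j), specializes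
    to [h] at every A-point [h] ([generic_eval]). Every identity that defines
    points holds for all [h], hence for the generic map ([generic_apoint]),
    and specialization of the generic point is the bijection between
    homomorphisms to [A] and A-points ([coord_apt_bij]). The algebra is
    commutative for the same reason, and it is non-zero because Mor(H, S)
    contains the trivial morphism H -> k^p -> S.

    The k-points are Mor(H, S) because S (x) k = S. Functoriality in [S] is
    Yoneda's lemma: a morphism S -> S' turns the generic point with values in
    [S] into a point with values in [S'] over the same algebra
    ([affine_structure_morphism]).

    The algebra k[Gamma] has finite dimension because a product of arrows
    vanishes unless the arrows decrease from left to right, and there are only
    finitely many decreasing words ([findim_quiver_alg]). *)

(** * Finite-dimensional spaces *)

Section Span.
Variables (k : fieldType) (V : lmodType k) (I : finType) (b : I -> V).

Definition inspan (x : V) : Prop := exists c : I -> k, x = \sum_i c i *: b i.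

Lemma inspan0 : inspan 0.
Proof. by exists (fun=> 0); rewrite big1 // => i _; rewrite scale0r. Qed.

Lemma inspanD x y : inspan x -> inspan y -> inspan (x + y).
Proof.
move=> [c ->] [e ->]; exists (fun i => c i + e i).
by rewrite -big_split; apply: eq_bigr => i _; rewrite scalerDl.
Qed.

Lemma inspanZ a x : inspan x -> inspan (a *: x).
Proof.
move=> [c ->]; exists (fun i => a * c i); rewrite scaler_sumr.
by apply: eq_bigr => i _; rewrite scalerA.
Qed.

Lemma inspan_gen i : inspan (b i).
Proof.
exists (fun j => (j == i)%:R); rewrite (bigD1 i) //= eqxx scale1r.
by rewrite big1 ?addr0 // => j /negbTE ->; rewrite scale0r.
Qed.

Lemma findim_span : (forall x, inspan x) -> findim V.
Proof.
move=> bV; exists #|I|, (fun j => b (enum_val j)) => x; have [c ->] := bV x.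
exists (fun j => c (enum_val j)).
by rewrite (reindex _ (onW_bij _ (@enum_val_bij I))).
Qed.

End Span.

(** A spanning family of the smallest possible size is a basis, and the
    coefficients along a basis are linear forms. *)
Lemma findim_dual (k : fieldType) (V : lmodType k) : findim V ->
  exists (d : nat) (b : 'I_d -> V) (phi : 'I_d -> {linear V -> k^o}),
    forall x, x = \sum_i (phi i x : k) *: b i.
Proof.
move=> fV.
have exP : exists d, `[< exists b : 'I_d -> V, forall x,
    exists c : 'I_d -> k, x = \sum_i c i *: b i >].
  by case: fV => d [b bP]; exists d; apply/asboolP; exists b.
case: (ex_minnP exP) => d /asboolP[b spanb] dmin.
have freeb (c : 'I_d -> k) : \sum_i c i *: b i = 0 -> forall i, c i = 0.
  move=> c0 i; apply/eqP; apply: contraT => ci.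
  (* If c_i is non-zero, then b_i is a combination of the other b_j, and
     leaving it out gives a smaller spanning family. *)
  case: d b spanb dmin c c0 i ci => [|d] b spanb dmin c c0 i ci.
    by case: i ci.
  suff: (d.+1 <= d)%N by rewrite ltnn.
  apply: dmin; apply/asboolP; exists (fun j => b (lift i j)) => x.
  have [e ->] := spanb x.
  exists (fun j => e (lift i j) - e i / c i * c (lift i j)).
  have bi : b i = - \sum_j (c (lift i j) / c i) *: b (lift i j).
    move: c0; rewrite (bigD1_ord i) //= => /eqP; rewrite addr_eq0 => /eqP c0.
    rewrite -[LHS](scalerK ci) c0 scalerN scaler_sumr; congr (- _).
    by apply: eq_bigr => j _; rewrite scalerA mulrC.
  rewrite (bigD1_ord i) //= bi scalerN addrC scaler_sumr -sumrB.
  by apply: eq_bigr => j _; rewrite scalerA -scalerBl mulrA mulrAC.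
have uniqb (c e : 'I_d -> k) :
    \sum_i c i *: b i = \sum_i e i *: b i -> c = e.
  move=> ce; apply: funext => i; apply/eqP; rewrite -subr_eq0; apply/eqP.
  apply: (freeb (fun i => c i - e i)).
  rewrite -[RHS](subrr (\sum_i e i *: b i)) -[in X in _ = X - _]ce -sumrB.
  by apply: eq_bigr => j _; rewrite scalerBl.
have [phi phiE] := choice spanb.
have phi_lin i : linear (fun x => phi x i : k^o).
  move=> a x y.
  suff -> : phi (a *: x + y) = fun i => a * phi x i + phi y i by [].
  apply: uniqb; rewrite -phiE {1}(phiE x) {1}(phiE y) scaler_sumr -big_split.
  by apply: eq_bigr => j _; rewrite /= scalerDl scalerA.
pose Phi i : {linear V -> k^o} :=
  HB.pack (fun x => phi x i : k^o)
    (GRing.isLinear.Build k V k^o _ _ (phi_lin i)).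
by exists d, b, Phi => x; exact: phiE.
Qed.

(** * Additive, multiplicative and linear maps *)

Lemma zmod_morphism0 (U V : zmodType) (f : U -> V) : zmod_morphism f -> f 0 = 0.
Proof. by move=> fB; rewrite -[X in f X](subrr 0) fB subrr. Qed.

Lemma zmod_morphismD (U V : zmodType) (f : U -> V) :
  zmod_morphism f -> {morph f : x y / x + y}.
Proof.
move=> fB x y; rewrite -[y in LHS]opprK fB -[- y]sub0r fB.
by rewrite zmod_morphism0 // sub0r opprK.
Qed.

Lemma ring_hom_comp (A B C : pzRingType) (g : B -> C) (f : A -> B) :
  ring_hom g -> ring_hom f -> ring_hom (g \o f).
Proof.
move=> [gB [g1 gM]] [fB [f1 fM]]; split=> [x y|] /=; first by rewrite fB gB.
by split=> [|x y] /=; rewrite ?f1 ?fM.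
Qed.

Lemma is_alg_hom_id (k : fieldType) (A : algType k) : is_alg_hom (@id A).
Proof. by []. Qed.

(** * Functoriality of the tensor product of algebras *)

Section TensorMap.
Variable k : fieldType.

Lemma tens_eq (V W U : lmodType k) (f g : tens V W -> U) :
  {morph f : x y / x + y} -> {morph g : x y / x + y} -> f 0 = g 0 ->
  (forall v w, f (tpure v w) = g (tpure v w)) -> f =1 g.
Proof.
move=> fD gD fg0 fg; elim/tens_ind=> // x y fx fy.
by rewrite fD gD fx fy.
Qed.

Variables A A' B B' : algType k.
Implicit Types (f : A -> A') (g : B -> B').

Lemma talg_map_bilin f g : is_alg_hom f -> is_alg_hom g ->
  bilin (fun a b => tpair (f a) (g b)).
Proof.
move=> [[fB _] fZ] [[gB _] gZ].
have fD := zmod_morphismD fB; have gD := zmod_morphismD gB.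
have tB := tpure_bilin A' B'.
split=> *; rewrite /tpair ?fD ?gD ?fZ ?gZ.
- exact: bilinDl.
- exact: bilinDr.
- exact: bilinZl.
- exact: bilinZr.
Qed.

Section Hom.
Variables (f : A -> A') (g : B -> B').
Hypotheses (fh : is_alg_hom f) (gh : is_alg_hom g).
Let fgB := talg_map_bilin fh gh.

Lemma talg_map_pair a b : talg_map f g (tpair a b) = tpair (f a) (g b).
Proof. exact: tlift_pure. Qed.

Lemma talg_mapD : {morph talg_map f g : x y / x + y}.
Proof. exact: tliftD. Qed.

Lemma talg_map0 : talg_map f g 0 = 0.
Proof. exact: tlift0. Qed.

Lemma talg_map_hom : ring_hom (talg_map f g).
Proof.
have mZ := tliftZ fgB.
split=> [x y|].
  by rewrite -scaleN1r [LHS]talg_mapD [X in _ + X]mZ scaleN1r.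
split=> [|x y].
  have [[_ [f1 _]] _] := fh; have [[_ [g1 _]] _] := gh.
  by rewrite talg_map_pair f1 g1.
have [[_ [_ fM]] _] := fh; have [[_ [_ gM]] _] := gh.
elim/tens_ind: x => [|a b|x x' IH IH'].
- by rewrite mul0r talg_map0 mul0r.
- elim/tens_ind: y => [|c d|y y' IH IH'].
  + by rewrite mulr0 talg_map0 mulr0.
  + rewrite -/(tpair a b) -/(tpair c d) tpairM !talg_map_pair tpairM.
    by rewrite fM gM.
  + by rewrite mulrDr !talg_mapD mulrDr IH IH'.
- by rewrite mulrDl !talg_mapD mulrDl IH IH'.
Qed.

End Hom.
End TensorMap.

Lemma talg_map_comp (k : fieldType) (A A' A'' B B' B'' : algType k)
    (f : A -> A') (f' : A' -> A'') (g : B -> B') (g' : B' -> B'') t :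
  is_alg_hom f -> is_alg_hom f' -> is_alg_hom g -> is_alg_hom g' ->
  talg_map f' g' (talg_map f g t) = talg_map (f' \o f) (g' \o g) t.
Proof.
move=> fh f'h gh g'h.
have ffh := is_alg_hom_comp f'h fh; have ggh := is_alg_hom_comp g'h gh.
move: t; apply: (tens_eq (f := fun t => talg_map f' g' (talg_map f g t))
  (g := talg_map (f' \o f) (g' \o g))) => [x y|x y||a b].
- by rewrite !talg_mapD.
- by rewrite talg_mapD.
- by rewrite !talg_map0.
- by rewrite -/(tpair a b) !talg_map_pair.
Qed.

(** * Morphisms and points with values in commutative algebras *)

Section Points.
Variables (k : fieldType) (p : nat).
Implicit Types H S T : pAlg k p.

(** Multiplication by [c] is multiplication by the image of [c] in k^p, so the
    morphisms of pointed algebras are linear. *)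
Lemma pmor_alg_hom S T (f : Mor S T) : is_alg_hom (sval f).
Proof.
have [[fB [f1 fM]] fi _] := svalP f; split=> // c x.
have [_ [pin1 _]] := pin_hom S; have [_ [pin1T _]] := pin_hom T.
rewrite -[x in LHS]mul1r -pin1 scalerAl -pinZ fM fi pinZ pin1T.
by rewrite -scalerAl mul1r.
Qed.

Lemma pout_bilin S (A : algType k) i :
  bilin (fun (s : S) (a : A) => (pout s i : k) *: a).
Proof.
have [pB _] := pout_hom S.
split=> [s s' a|s a a'|c s a|c s a].
- by rewrite (zmod_morphismD pB) ffunE scalerDl.
- by rewrite scalerDr.
- by rewrite poutZ ffunE scalerA.
- by rewrite !scalerA mulrC.
Qed.

Lemma pout_tens_pair S (A : algType k) (s : S) (a : A) i :
  pout_tens (tpair s a) i = (pout s i : k) *: a.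
Proof. exact: (tlift_pure (pout_bilin S A i)). Qed.

Lemma pout_tens_map S T (A B : algType k) (f : Mor S T) (g : A -> B)
    (t : talg S A) i :
  is_alg_hom g -> pout_tens (talg_map (sval f) g t) i = g (pout_tens t i).
Proof.
move=> gh; have fh := pmor_alg_hom f; have [_ _ fo] := svalP f.
have [[gB _] gZ] := gh; have pB := pout_bilin; move: t.
apply: (tens_eq (f := fun t => pout_tens (talg_map (sval f) g t) i)
                (g := fun t => g (pout_tens t i))) => [x y|x y||s a].
- by rewrite talg_mapD //; exact: tliftD.
- by rewrite -(zmod_morphismD gB); congr g; exact: tliftD.
- by rewrite talg_map0 // /pout_tens !tlift0 // zmod_morphism0.
- by rewrite -/(tpair s a) talg_map_pair // !pout_tens_pair fo gZ.
Qed.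

Lemma is_apoint_map H S T (A B : comAlgType k) (f : Mor S T) (g : A -> B)
    (h : H -> talg S A) :
  is_alg_hom g -> is_apoint h -> is_apoint (talg_map (sval f) g \o h).
Proof.
move=> gh [hh hi ho]; have fh := pmor_alg_hom f; have [_ fi _] := svalP f.
have [[_ [g1 _]] gZ] := gh.
split=> [|v|x i] /=.
- by apply: ring_hom_comp => //; exact: talg_map_hom.
- by rewrite hi talg_map_pair // fi g1.
- by rewrite pout_tens_map // ho gZ g1.
Qed.

Lemma pmor_id S : pmor (@id S).
Proof. by []. Qed.

Definition mor_id S : Mor S S := exist _ _ (pmor_id S).

Lemma tpair1_hom S (A : algType k) : ring_hom (fun s : S => tpair s (1 : A)).
Proof.
have tB := tpure_bilin S A.
split=> [x y|]; last by split=> // x y; rewrite tpairM mulr1.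
by rewrite /tpair (bilinDl tB) -scaleN1r (bilinZl tB) scaleN1r.
Qed.

Lemma is_apoint_tpair1 H S (A : comAlgType k) (h : H -> S) :
  pmor h -> is_apoint (fun x => tpair (h x) (1 : A)).
Proof.
move=> [hh hi ho]; split=> [|v|x i].
- exact: (ring_hom_comp (tpair1_hom S A) hh).
- by rewrite hi.
- by rewrite pout_tens_pair ho.
Qed.

Lemma pmor_trivial H S : pmor (@pin k p S \o @pout k p H).
Proof.
split=> [|v|x] /=; last by rewrite pinK.
- exact: ring_hom_comp (pin_hom S) (pout_hom H).
- by rewrite pinK.
Qed.

(** The isomorphism S (x)_k k = S. *)
Definition counit S (t : talg S (k^o : comAlgType k)) : S :=
  tlift (fun (s : S) (a : k^o) => (a : k) *: s) t.

Lemma counit_bilin S : bilin (fun (s : S) (a : k^o) => (a : k) *: s).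
Proof.
split=> [s s' a|s a a'|c s a|c s a].
- by rewrite scalerDr.
- by rewrite scalerDl.
- by rewrite !scalerA mulrC.
- by rewrite scalerA.
Qed.

Lemma counit_pair S (s : S) (a : k^o) : counit (tpair s a) = (a : k) *: s.
Proof. exact: (tlift_pure (counit_bilin S)). Qed.

Lemma counitK S (t : talg S (k^o : comAlgType k)) : tpair (counit t) 1 = t.
Proof.
have tB := tpure_bilin S k^o.
move: t; apply: (tens_eq (f := fun t => tpair (counit t) 1) (g := id)) =>
  [x y|//||s a].
- rewrite /tpair -(bilinDl tB); congr tpure.
  exact: (tliftD (counit_bilin S)).
- rewrite /counit (tlift0 (counit_bilin S)) -(scale0r (0 : S)) /tpair.
  by rewrite (bilinZl tB) scale0r.
- rewrite -/(tpair s a) counit_pair /tpair (bilinZl tB) -(bilinZr tB).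
  by congr tpure; exact: mulr1.
Qed.

Lemma pmor_counit H S (h : H -> talg S (k^o : comAlgType k)) :
  is_apoint h -> pmor (fun x => @counit S (h x)).
Proof.
move=> [[hB [h1 hM]] hi ho].
have can (u v : S) : tpair u (1 : k^o) = tpair v 1 -> u = v.
  by move=> /(congr1 (@counit S)); rewrite !counit_pair !scale1r.
have [tB [t1 tM]] := tpair1_hom S k^o.
split=> [|v|x].
- split=> [x y|]; first by apply: can; rewrite tB !counitK hB.
  by split=> [|x y]; apply: can; rewrite ?tM ?counitK ?h1 ?hM.
- by apply: can; rewrite counitK hi.
- apply/ffunP => i; have := ho x i; rewrite -(counitK (h x)) pout_tens_pair.
  rewrite counitK => /eqP; rewrite -subr_eq0 -scalerBl scaler_eq0 oner_eq0.
  by rewrite orbF subr_eq0 => /eqP.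
Qed.

End Points.

(** * The coordinate ring and the generic point *)

Section CoordinateRing.
Variables (k : fieldType) (p : nat) (H S : pAlg k p).
Variables (d : nat) (b : 'I_d -> S) (phi : 'I_d -> {linear S -> k^o}).

(** The map phi_j (x) A : S (x) A -> A. *)
Definition tcoord (A : algType k) (j : 'I_d) (t : talg S A) : A :=
  tlift (fun (s : S) (a : A) => (phi j s : k) *: a) t.

Lemma tcoord_bilin (A : algType k) j :
  bilin (fun (s : S) (a : A) => (phi j s : k) *: a).
Proof.
split=> [s s' a|s a a'|c s a|c s a].
- by rewrite linearD scalerDl.
- by rewrite scalerDr.
- by rewrite linearZ scalerA.
- by rewrite !scalerA mulrC.
Qed.

Lemma tcoord_pair (A : algType k) j s (a : A) :
  tcoord j (tpair s a) = (phi j s : k) *: a.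
Proof. exact: (tlift_pure (tcoord_bilin A j)). Qed.

Lemma tcoord_map (A B : algType k) (g : A -> B) j (t : talg S A) :
  is_alg_hom g -> tcoord j (talg_map id g t) = g (tcoord j t).
Proof.
move=> gh; have [[gB _] gZ] := gh; have idh := @is_alg_hom_id k S.
have cB := tcoord_bilin; move: t.
apply: (tens_eq (f := fun t => tcoord j (talg_map id g t))
                (g := fun t => g (tcoord j t))) => [x y|x y||s a].
- by rewrite talg_mapD //; exact: tliftD.
- by rewrite -(zmod_morphismD gB); congr g; exact: tliftD.
- by rewrite talg_map0 // /tcoord !tlift0 // zmod_morphism0.
- by rewrite -/(tpair s a) talg_map_pair // !tcoord_pair gZ.
Qed.

Definition point_val (A : comAlgType k) (h : apoint H S A)
    (xj : H * 'I_d) : A :=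
  tcoord xj.2 (sval h xj.1).

(** The relations are taken to hold at all points, and not to be generated by
    the equations that define points: the two descriptions give the same
    algebra, but this one makes the separation of elements by points hold by
    definition. *)
Definition point_rel (s t : aterm k (H * 'I_d)) : Prop :=
  forall (A : comAlgType k) (h : apoint H S A),
    aeval (point_val h) s = aeval (point_val h) t.

Definition coord_ring : Type := palg point_rel.
HB.instance Definition _ := GRing.Lmodule.on coord_ring.
HB.instance Definition _ := GRing.PzRing.on coord_ring.

Definition point_eval (A : comAlgType k) (h : apoint H S A) :
  coord_ring -> A := palg_lift (point_val h).

Lemma point_relE (A : comAlgType k) (h : apoint H S A) s t :
  point_rel s t -> aeval (point_val h) s = aeval (point_val h) t.
Proof. exact. Qed.

Lemma point_eval_sep (u v : coord_ring) :
  (forall (A : comAlgType k) (h : apoint H S A),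
    point_eval h u = point_eval h v) -> u = v.
Proof.
elim/quotW: u => s; elim/quotW: v => t uv.
apply/palg_eq/AEbase => A h.
by have := uv A h; rewrite /point_eval !(palg_lift_pi (@point_relE A h)).
Qed.

Lemma coord_ring_mulC : commutative (@GRing.mul coord_ring).
Proof.
move=> u v; apply: point_eval_sep => A h.
by rewrite /point_eval !(palg_liftM (@point_relE A h)) mulrC.
Qed.
HB.instance Definition _ :=
  GRing.PzRing_hasCommutativeMul.Build coord_ring coord_ring_mulC.

(** The morphism H -> k^p -> S, as a k-point. *)
Definition trivial_point : apoint H S (k^o : comAlgType k) :=
  exist _ _ (is_apoint_tpair1 k^o (pmor_trivial H S)).

Lemma coord_ring_neq0 : (1 : coord_ring) != 0.
Proof.
apply/eqP => e10; have /eqP[] := oner_neq0 k.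
have hE := @point_relE k^o trivial_point.
transitivity (point_eval trivial_point 1).
  exact: (esym (palg_lift1 hE)).
by rewrite e10 -(scale0r 0) [LHS](palg_liftZ hE) scale0r.
Qed.
HB.instance Definition _ :=
  GRing.PzSemiRing_isNonZero.Build coord_ring coord_ring_neq0.
HB.instance Definition _ := GRing.Lmodule_isLalgebra.Build k coord_ring
  (@palg_scaleAl k _ point_rel).
HB.instance Definition _ := GRing.Lalgebra_isAlgebra.Build k coord_ring
  (@palg_scaleAr k _ point_rel).

Lemma point_eval_hom (A : comAlgType k) (h : apoint H S A) :
  is_alg_hom (point_eval h).
Proof.
have hE := @point_relE A h.
have eZ c : {morph point_eval h : u / c *: u} := palg_liftZ hE c.
split=> //; split=> [u v|].
  by rewrite -scaleN1r [LHS](palg_liftD hE) [X in _ + X]eZ scaleN1r.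
by split; [exact: palg_lift1 hE|exact: palg_liftM hE].
Qed.

Hypothesis b_phi : forall s, s = \sum_j (phi j s : k) *: b j.

Lemma talg_coord (A : algType k) (t : talg S A) :
  t = \sum_j tpair (b j) (tcoord j t).
Proof.
have tB := tpure_bilin S A; have cB := tcoord_bilin A; move: t.
apply: (tens_eq (f := id)
  (g := fun t => \sum_j tpair (b j) (tcoord j t))) => [//|x y||s a].
- rewrite -big_split; apply: eq_bigr => j _ /=.
  by rewrite /tpair -(bilinDr tB); congr tpure; exact: tliftD.
- rewrite big1 // => j _; rewrite /tcoord tlift0 // -(scale0r (0 : A)) /tpair.
  by rewrite (bilinZr tB) scale0r.
- rewrite -[LHS]/(tpair s a) [in LHS](b_phi s).
  transitivity (\sum_j tpair ((phi j s : k) *: b j) a).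
    apply: (big_morph (fun s => tpair s a)) => [x y|].
      exact: (bilinDl tB).
    by rewrite -(scale0r (0 : S)) /tpair (bilinZl tB) scale0r.
  apply: eq_bigr => j _; rewrite tcoord_pair /tpair.
  by rewrite (bilinZl tB) (bilinZr tB).
Qed.

Lemma tcoord_inj (A : algType k) (t u : talg S A) :
  (forall j, tcoord j t = tcoord j u) -> t = u.
Proof.
move=> tu; rewrite (talg_coord t) (talg_coord u).
by apply: eq_bigr => j _; rewrite tu.
Qed.

(** The generic point: all points are specializations of it. *)
Definition generic (x : H) : talg S (coord_ring : algType k) :=
  \sum_j tpair (b j) (agen point_rel (x, j) : coord_ring).

Lemma generic_eval (A : comAlgType k) (h : apoint H S A) x :
  talg_map id (point_eval h) (generic x) = sval h x.
Proof.
have eh := point_eval_hom h; have idh := @is_alg_hom_id k S.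
rewrite [RHS]talg_coord /generic.
rewrite (big_morph _ (talg_mapD idh eh) (talg_map0 idh eh)).
apply: eq_bigr => j _; rewrite talg_map_pair //; congr tpair.
exact: (palg_lift_gen (@point_relE A h)).
Qed.

(** An element of [S (x) coord_ring] is given by finitely many coordinates in
    [coord_ring], which are separated by points. *)
Lemma talg_sep (t u : talg S (coord_ring : algType k)) :
  (forall (A : comAlgType k) (h : apoint H S A),
    talg_map id (point_eval h) t = talg_map id (point_eval h) u) -> t = u.
Proof.
move=> tu; apply: tcoord_inj => j; apply: point_eval_sep => A h.
by rewrite -!(tcoord_map _ _ (point_eval_hom h)) tu.
Qed.

(** Each condition is an equality in [S (x) coord_ring] or in [coord_ring] that
    can be tested after evaluation at a point [h], where the generic map
    becomes [h]. *)
Lemma generic_apoint :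
  is_apoint (generic : H -> talg S (coord_ring : comAlgType k)).
Proof.
have idh := @is_alg_hom_id k S.
split=> [|v|x i].
- split=> [x y|]; last split=> [|x y].
  + apply: talg_sep => A h; have [[hB _] _ _] := svalP h.
    have [mB _] := talg_map_hom idh (point_eval_hom h).
    by rewrite mB !generic_eval hB.
  + apply: talg_sep => A h; have [[_ [h1 _]] _ _] := svalP h.
    have [_ [m1 _]] := talg_map_hom idh (point_eval_hom h).
    by rewrite m1 generic_eval h1.
  + apply: talg_sep => A h; have [[_ [_ hM]] _ _] := svalP h.
    have [_ [_ mM]] := talg_map_hom idh (point_eval_hom h).
    by rewrite mM !generic_eval hM.
- apply: talg_sep => A h; have [_ hi _] := svalP h.
  have eh := point_eval_hom h; have [[_ [e1 _]] _] := eh.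
  by rewrite generic_eval talg_map_pair // hi e1.
- apply: point_eval_sep => A h; have [_ _ ho] := svalP h.
  have eh := point_eval_hom h; have [[_ [e1 _]] eZ] := eh.
  by rewrite -(pout_tens_map (mor_id S)) // generic_eval ho eZ e1.
Qed.

(** The hypothesis [b_phi] does not say that the family [b] is free, so this is
    not formal. It holds because it holds at every point. *)
Lemma tcoord_generic x j :
  tcoord j (generic x) = (agen point_rel (x, j) : coord_ring).
Proof.
apply: point_eval_sep => A h; rewrite -(tcoord_map _ _ (point_eval_hom h)).
rewrite generic_eval; symmetry.
exact: (palg_lift_gen (@point_relE A h)).
Qed.

Definition coord_apt (A : comAlgType k)
    (f : alg_hom (coord_ring : comAlgType k) A) : apoint H S A :=
  exist _ _ (is_apoint_map (mor_id S) (svalP f) generic_apoint).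

Lemma alg_hom_coord_eq (A : comAlgType k)
    (f g : alg_hom (coord_ring : comAlgType k) A) :
  (forall x j,
    sval f (agen point_rel (x, j)) = sval g (agen point_rel (x, j))) ->
  f = g.
Proof.
case: f g => f fh [g gh] /= fg; apply: eq_exist; apply: funext => u.
have [[fB [f1 fM]] fZ] := fh; have [[gB [g1 gM]] gZ] := gh.
elim/palg_ind: u => [||[x j]|u v IHu IHv|u v IHu IHv|c u IHu].
- exact: etrans (zmod_morphism0 fB) (esym (zmod_morphism0 gB)).
- exact: etrans f1 (esym g1).
- exact: fg.
- by rewrite [LHS](zmod_morphismD fB) [RHS](zmod_morphismD gB) IHu IHv.
- by rewrite [LHS]fM [RHS]gM IHu IHv.
- by rewrite [LHS]fZ [RHS]gZ IHu.
Qed.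

Lemma coord_apt_bij (A : comAlgType k) : bijective (@coord_apt A).
Proof.
exists (fun h => exist _ (point_eval h) (point_eval_hom h)) => [f|h].
- apply: alg_hom_coord_eq => x j /=.
  rewrite /point_eval (palg_lift_gen (@point_relE A (coord_apt f))).
  rewrite /point_val /=.
  by rewrite (tcoord_map _ _ (svalP f)) tcoord_generic.
- case: h => h hP; apply: eq_exist; apply: funext => x /=.
  exact: (generic_eval (exist _ h hP)).
Qed.

End CoordinateRing.

(** * Affine structures *)

Section Representability.
Variables (k : fieldType) (p : nat).
Implicit Types H S : pAlg k p.

Definition counit_mor H S (h : apoint H S (k^o : comAlgType k)) : Mor H S :=
  exist _ _ (pmor_counit (svalP h)).

Lemma counit_mor_bij H S : bijective (@counit_mor H S).
Proof.
exists (fun f => exist _ _ (is_apoint_tpair1 k^o (svalP f))) =>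
  [[h hP]|[f fP]].
- by apply: eq_exist; apply: funext => x /=; rewrite counitK.
- by apply: eq_exist; apply: funext => x /=; rewrite counit_pair scale1r.
Qed.

Lemma affine_structure_exists H S :
  findim S -> inhabited (affine_structure H S).
Proof.
move=> /findim_dual[d [b [phi b_phi]]]; apply: inhabits.
pose B := coord_ring H phi : comAlgType k.
pose ap := @coord_apt k p H S d b phi b_phi.
pose kp (f : alg_hom B k^o) := counit_mor (ap _ f).
apply: (@AffineStructure k p H S B ap _ _ kp).
- exact: coord_apt_bij.
- move=> A A' g f x /=.
  have idh := @is_alg_hom_id k S.
  by rewrite talg_map_comp //; [exact: svalP f|exact: svalP g].
- exact: bij_comp (counit_mor_bij H S) (coord_apt_bij H b_phi k^o).
- by move=> f x; rewrite [RHS]counitK.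
Qed.

(** This holds for arbitrary affine structures: if [e] is the identity of
    [coord X], then [apt X e] is the generic point, its image by [f] is an
    S'-valued point over [coord X], and so it comes from a homomorphism
    [coord X' -> coord X]. *)
Lemma affine_structure_morphism H S S' (X : affine_structure H S)
    (X' : affine_structure H S') (f : Mor S S') : affine_morphism X X' f.
Proof.
pose e : alg_hom (Defs.coord X) (Defs.coord X) :=
  exist _ _ (is_alg_hom_id (Defs.coord X)).
have idh := @is_alg_hom_id k.
have fh := pmor_alg_hom f; have eh := svalP e.
have [q _ qK] := apt_bij X' (Defs.coord X).
exists (q (exist _ _ (is_apoint_map f eh (svalP (apt X e))))) => A g x.
rewrite apt_nat qK /=.
have gE : alg_comp g e = g by case: (g) => ? ?; exact: eq_exist.
rewrite -[in RHS]gE apt_nat.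
by rewrite !talg_map_comp //; exact: svalP g.
Qed.

End Representability.

(** * Finite dimension of the algebra of an ordered quiver *)

Section QuiverFinite.
Variables (k : fieldType) (p : nat) (G : oquiver p).
Local Notation m := (arrows G).

Definition qarrow (a : 'I_m) : qalg k G := agen (@quiver_rel k p G) (inr a).

Lemma qarrow_tgtsrc a :
  qidem k G (tgt a) * qarrow a * qidem k G (src a) = qarrow a.
Proof. by have /AEbase/palg_eq := QRx k a; rewrite -!pa_mulE. Qed.

Lemma qidem_arrow i a :
  qidem k G i * qarrow a = if i == tgt a then qarrow a else 0.
Proof.
rewrite -{1}qarrow_tgtsrc !mulrA qidemM; case: eqP => [->|_].
  exact: qarrow_tgtsrc.
by rewrite !mul0r.
Qed.

Lemma qarrow_idem a i :
  qarrow a * qidem k G i = if src a == i then qarrow a else 0.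
Proof.
rewrite -{1}qarrow_tgtsrc -!mulrA qidemM; case: eqP => _.
  by rewrite mulrA qarrow_tgtsrc.
by rewrite !mulr0.
Qed.

Lemma qarrowM0 (a b : 'I_m) : ~~ (a < b)%N -> qarrow b * qarrow a = 0.
Proof. by move=> /(QRzero k)/AEbase/palg_eq; rewrite -pa_mulE. Qed.

Definition qword (s : seq 'I_m) : qalg k G := \prod_(a <- s) qarrow a.

Lemma qword_cons a s : qword (a :: s) = qarrow a * qword s.
Proof. exact: big_cons. Qed.

Local Notation gto := (fun a b : 'I_m => (b < a)%N).

Lemma gto_trans : transitive gto.
Proof. by move=> b a c /= ba cb; exact: ltn_trans cb ba. Qed.

Lemma sorted_desc_enum (A : pred 'I_m) :
  sorted gto [seq a <- rev (enum 'I_m) | A a].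
Proof.
apply: (sorted_filter gto_trans); rewrite rev_sorted.
by have := iota_ltn_sorted 0 m; rewrite -val_enum_ord sorted_map.
Qed.

(** The idempotents and the words in decreasing order of arrows. The latter are
    indexed by the sets of their letters, to have a finite index type. *)
Definition qfam (i : 'I_p + {set 'I_m}) : qalg k G :=
  match i with
  | inl i => qidem k G i
  | inr A => qword [seq a <- rev (enum 'I_m) | a \in A]
  end.

Lemma qword_span s : sorted gto s -> inspan qfam (qword s).
Proof.
move=> ss; have -> : qword s = qfam (inr [set a in s]).
  congr qword; apply: (irr_sorted_eq gto_trans) => //.
  - by move=> a; rewrite /= ltnn.
  - exact: sorted_desc_enum.
  - by move=> a; rewrite mem_filter inE mem_rev mem_enum andbT.
exact: inspan_gen.
Qed.

Lemma qidem_qfam i j : inspan qfam (qidem k G i * qfam j).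
Proof.
case: j => [j|A] /=.
  rewrite qidemM; case: eqP => _; last exact: inspan0.
  exact: (inspan_gen qfam (inl i)).
have := sorted_desc_enum (mem A).
case: [seq _ <- _ | _] => [_|a s ss].
  rewrite /qword big_nil mulr1; exact: (inspan_gen qfam (inl i)).
rewrite qword_cons mulrA qidem_arrow; case: eqP => _.
  by rewrite -qword_cons; exact: qword_span.
by rewrite mul0r; exact: inspan0.
Qed.

Lemma qarrow_qfam b j : inspan qfam (qarrow b * qfam j).
Proof.
have b1 : inspan qfam (qarrow b).
  have -> : qarrow b = qword [:: b].
    by rewrite qword_cons [qword [::]]big_nil mulr1.
  exact: qword_span.
case: j => [j|A] /=.
  by rewrite qarrow_idem; case: eqP => _; [|exact: inspan0].
have := sorted_desc_enum (mem A).
case: [seq _ <- _ | _] => [_|a s ss]; first by rewrite /qword big_nil mulr1.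
case: (boolP (a < b)%N) => ab.
  by rewrite -qword_cons; apply: qword_span; rewrite /= ab.
by rewrite qword_cons mulrA qarrowM0 // mul0r; exact: inspan0.
Qed.

(** The span of [qfam] contains 1 and is stable under left multiplication by the
    generators, so it is everything. *)
Lemma findim_quiver_alg : findim (quiver_alg k G).
Proof.
apply: (findim_span (b := qfam)) => u.
suff uP : forall i, inspan qfam (u * qfam i).
  have [c c1] : inspan qfam 1.
    rewrite -qidem_sum; apply: (big_ind (inspan qfam));
      [exact: inspan0|exact: inspanD|move=> i _].
    exact: (inspan_gen qfam (inl i)).
  rewrite -[u]mulr1 c1 mulr_sumr; apply: (big_ind (inspan qfam));
    [exact: inspan0|exact: inspanD|move=> i _].
  by rewrite -scalerAr; apply: inspanZ.
elim/palg_ind: u => [||[j|a]|u v IHu IHv|u v IHu IHv|c u IHu] i.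
- by rewrite [0 * _]mul0r; exact: inspan0.
- by rewrite [1 * _]mul1r; exact: inspan_gen.
- exact: qidem_qfam.
- exact: qarrow_qfam.
- by rewrite [X in inspan _ X]mulrDl; exact: inspanD.
- rewrite -[X in inspan _ X]mulrA; have [c ->] := IHv i.
  rewrite mulr_sumr; apply: (big_ind (inspan qfam));
    [exact: inspan0|exact: inspanD|move=> j _].
  by rewrite -scalerAr; apply: inspanZ.
- by rewrite -[X in inspan _ X]scalerAl; exact: inspanZ.
Qed.

End QuiverFinite.

Local Close Scope ring_scope.

Theorem proposition9 (k : closedFieldType) (R : algType k) (p : nat)
    (M : 'I_p -> lmodType R)
    (ext_fin : forall (m : nat) (i j : 'I_p), m = 1 \/ m = 2 ->
       ext_findim m (M i) (M j))
    (H : pAlg k p) (hullH : is_hull M H) :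
  (exists X : forall S : aObj k p, affine_structure H S,
     forall (S S' : aObj k p) (f : Mor S S'),
       affine_morphism (X S) (X S') f) /\
  (forall G : oquiver p, inhabited (affine_structure H (quiver_alg k G))).
Proof.
have aff (S : aObj k p) : inhabited (affine_structure H S).
  by apply: affine_structure_exists; have [] := aalgP S.
split=> [|G]; last exact/affine_structure_exists/findim_quiver_alg.
exists (fun S => inhabited_witness (aff S)) => S S' f.
exact: affine_structure_morphism.
Qed.
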